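(* Let $L(m,n)=3\frac{m^2+m}{2}+2nm+n^2+n$ and let $N$ be a non-negative integer. Then \begin{align*} \sum_{\pi\in\ell\mathcal{G}_{1,N}}x^{\#(\pi)}q^{|\pi|}=&\sum_{m,n\ge0}x^{m+n}q^{L(m,n)}{N-2m-2n \brack m}_q{\lfloor\frac N2\rfloor-m-n+\lfloor\frac n2\rfloor \brack \lfloor\frac n2\rfloor}_{q^4}\\ &+\sum_{m,n\ge0}x^{m+n+1}q^{L(m,n)+2m+2n+1}{N-2m-2n-2 \brack m}_q{\lfloor\frac N2\rfloor-m-n-1+\lfloor\frac n2\rfloor \brack \lfloor\frac n2\rfloor}_{q^4}+\delta_{N,1}\,xq, \end{align*} \[ \sum_{\pi\in\ell\mathcal{G}_{2,N}}x^{\#(\pi)}q^{|\pi|}=\sum_{m,n\ge0}x^{m+n}q^{L(m,n)}{N-2m-2n \brack m}_q{\lfloor\frac N2\rfloor-m-n+\lfloor\frac n2\rfloor \brack \lfloor\frac n2\rfloor}_{q^4}. \]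
   Context: A partition is a finite non-decreasing sequence $\pi=(\lambda_1,\dots,\lambda_{\#(\pi)})$ of positive integers (the empty sequence is the unique partition of $0$); $\#(\pi)$ is its number of parts and $|\pi|$ the sum of its parts. For $i=1,2$, $\ell\mathcal{G}_{i,N}$ is the set of partitions all of whose parts are $\ge i$ and $\le N$, with $\lambda_j-\lambda_{j-1}\ge2$ for $j\ge2$ and $\lambda_j-\lambda_{j-1}\ge3$ whenever $\lambda_j$ is odd (no consecutive odd parts). For integers $A,B$ and base $p$, ${A\brack B}_p=\frac{(p;p)_A}{(p;p)_B(p;p)_{A-B}}$ if $0\le B\le A$ and $0$ otherwise, where $(a;p)_j=\prod_{i=0}^{j-1}(1-ap^i)$. $\delta_{i,j}$ is the Kronecker delta. *)

(* Defs.v *)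
From HB Require Import structures.
From mathcomp Require Import all_boot all_order all_algebra.
From mathcomp Require Import boolp classical_sets fsbigop.

Set Implicit Arguments.
Unset Strict Implicit.
Unset Printing Implicit Defensive.

Import Order.TTheory GRing.Theory Num.Theory.

Local Open Scope ring_scope.

Definition is_partition (s : seq nat) : bool :=
  sorted leq s && all (fun a => 0 < a)%N s.

(* [sorted] tests consecutive entries (a, b) = (lambda_(j-1), lambda_j), j >= 2;
   a truncated difference b - a bounded below by 2 forces a < b. *)
Definition little_gap (a b : nat) : bool :=
  (2 <= b - a)%N && (odd b ==> (3 <= b - a)%N).

Definition lG (i N : nat) : set (seq nat) :=
  [set s | [&& is_partition s,
               all (fun a => i <= a <= N)%N s
             & sorted little_gap s]]%classic.

Definition qpoch (F : fieldType) (a p : F) (j : nat) : F :=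
  \prod_(0 <= i < j) (1 - a * p ^+ i).

(* The quotient is the intended one only when p is not a root of unity, as
   otherwise the denominator may vanish. *)
Definition qbinom (F : fieldType) (p : F) (A B : int) : F :=
  if 0 <= B <= A
  then qpoch p p `|A|%N / (qpoch p p `|B|%N * qpoch p p `|A - B|%N)
  else 0.

(* The numerator is divisible by 2, so the truncated half is exact. *)
Definition L (m n : nat) : nat :=
  ((3 * (m ^ 2 + m))./2 + 2 * n * m + n ^ 2 + n)%N.

(* Main.v *)
(* Removing the largest part shows that the generating polynomial [P N] of
   [lG i N] satisfies [P N = P (N-1) + x q^N P (N - 2 - odd N)].  On the other
   side [L m n = j^2 + j + 'C(m+1, 2)] with [j = m + n], so the coefficient of
   [x^j] in the double sum is [q^(j^2 + j)] times the coefficient of [z^j] in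
     F_A(z) = (1 + z) (-z q; q)_A / (z^2; q^4)_(B+1),
   where [A = N - 2 j] and [B = A./2].  The same recurrence then follows from
     F_(2B+1) = (1 + z q^(2B+1)) F_(2B) and
     (1 - z q^(2B+2)) F_(2B+2) = F_(2B+1).
   Partitions containing the part 1 contribute [x q P (N-2)] evaluated at
   [x q^2], which solves the recurrence as well; the Kronecker delta accounts
   for [N = 1]. *)
Require Import Defs.
From HB Require Import structures.
From mathcomp Require Import all_boot all_order all_algebra.
From mathcomp Require Import zify ring.
From mathcomp Require Import boolp classical_sets cardinality fsbigop.

Import Order.TTheory GRing.Theory Num.Theory.

Local Open Scope ring_scope.

Set Implicit Arguments.
Unset Strict Implicit.

(** The support lies in the triangle [m + n <= N], which the antidiagonals [m + n = j] list without
    repetition. *)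
Lemma fsbig_antidiagonals (V : nmodType) (N : nat) (f : nat * nat -> V) :
    (forall m n, (N < (m + n).*2)%N -> f (m, n) = 0) ->
  \sum_(mn \in [set: nat * nat]) f mn
  = \sum_(j < N.+1) \sum_(m < j.+1) f (m : nat, (j - m)%N).
Proof.
move=> f0; pose r := [seq (m, j - m)%N | j <- iota 0 N.+1, m <- iota 0 j.+1].
have uniq_r : uniq r.
  apply: allpairs_uniq_dep => [|j _|]; [exact: iota_uniq| |].
    exact: iota_uniq.
  move=> [j m] [j' m'] /allpairsPdep[j1 [m1 [_ h1 [-> ->]]]].
  move=> /allpairsPdep[j2 [m2 [_ h2 [-> ->]]]] /= [].
  rewrite !mem_iota in h1 h2 => e1 e2; subst m2.
  have ej : j1 = j2 by lia.
  by rewrite ej.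
rewrite (fsbigE r) //= => [|[m n] _ notr].
  rewrite (eq_bigl xpredT) => [|mn]; last by rewrite in_setT.
  rewrite big_allpairs_dep -[iota 0 N.+1]/(index_iota 0 N.+1) big_mkord.
  by apply: eq_bigr => j _; rewrite -[iota 0 j.+1]/(index_iota 0 j.+1) big_mkord.
apply: f0; rewrite ltnNge; apply: contraNN notr => le.
apply/allpairsPdep; exists (m + n)%N, m; rewrite !mem_iota addKn.
by split=> //; lia.
Qed.

(** * Gaussian binomials and their Pascal rule *)

Section QBinomial.
Variables (F : fieldType) (p : F).

Lemma qpochS (a : F) n : qpoch a p n.+1 = qpoch a p n * (1 - a * p ^+ n).
Proof. by rewrite /qpoch big_nat_recr. Qed.

Lemma qbinomE (A B : nat) : (B <= A)%N ->
  qbinom p A B = qpoch p p A / (qpoch p p B * qpoch p p (A - B)).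
Proof. by move=> leBA; rewrite /qbinom lez_nat leBA /= distnEl. Qed.

Lemma qbinom_small (A B : nat) : (A < B)%N -> qbinom p A B = 0.
Proof. by move=> ltAB; rewrite /qbinom lez_nat leqNgt ltAB. Qed.

Hypothesis p_generic : forall k : nat, (0 < k)%N -> p ^+ k != 1.

Lemma qpoch_neq0 n : qpoch p p n != 0.
Proof.
elim: n => [|n IHn]; first by rewrite /qpoch big_geq ?oner_eq0.
by rewrite qpochS mulf_neq0 // -exprS subr_eq0 eq_sym p_generic.
Qed.

Lemma qbinom0 (A : nat) : qbinom p A 0 = 1.
Proof.
rewrite (qbinomE (leq0n A)) subn0 {2}/qpoch big_geq // mul1r divff //.
exact: qpoch_neq0.
Qed.

Lemma qbinomn (A : nat) : qbinom p A A = 1.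
Proof.
by rewrite qbinomE // subnn [qpoch p p 0]big_geq // mulr1 divff ?qpoch_neq0.
Qed.

Lemma qbinom_pascal (A m : nat) :
  qbinom p A.+1 m.+1 = qbinom p A m.+1 + p ^+ (A - m) * qbinom p A m.
Proof.
have [ltAm|] := ltnP A m.
  by rewrite !qbinom_small ?mulr0 ?addr0 // ?ltnS // ltnW.
have nz := qpoch_neq0; have g := p_generic.
have gS k : 1 - p * p ^+ k != 0 by rewrite -exprS subr_eq0 eq_sym g.
rewrite leq_eqVlt => /predU1P[->|ltmA].
  by rewrite (qbinom_small (ltnSn A)) !qbinomn subnn expr0 mul1r add0r.
have [d ->] : exists d, A = (m + d).+1 by exists (A - m.+1)%N; lia.
rewrite !qbinomE //; try lia.
have -> : ((m + d).+2 - m.+1 = d.+1)%N by lia.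
have -> : ((m + d).+1 - m.+1 = d)%N by lia.
have -> : ((m + d).+1 - m = d.+1)%N by lia.
rewrite !(qpochS _ m) !(qpochS _ d) !(qpochS _ (m + d).+1).
move: (nz m) (nz d) (gS m) (gS d).
rewrite -!exprS => Hm Hd Gm Gd.
(* With [u = p ^+ m.+1] and [v = p ^+ d.+1], what remains is [1 - u v = (1 - v) + v (1 - u)]. *)
have -> : p ^+ (m + d).+2 = p ^+ m.+1 * p ^+ d.+1 by rewrite -exprD; congr (_ ^+ _); lia.
by field; apply/and4P.
Qed.

End QBinomial.

(** * Coefficients of products of power series *)

Section Convolution.
Variable R : comNzRingType.
Implicit Types a b : nat -> R.

Definition conv a b (j : nat) : R := \sum_(m < j.+1) a m * b (j - m)%N.

Lemma conv0 a b : conv a b 0 = a 0%N * b 0%N.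
Proof. by rewrite /conv big_ord1. Qed.

(** In generating functions: [a' = (1 + c z) a], multiplied by [b]. *)
Lemma conv_recl a a' b c : a' 0%N = a 0%N ->
    (forall m, a' m.+1 = a m.+1 + c * a m) ->
  forall j, conv a' b j.+1 = conv a b j.+1 + c * conv a b j.
Proof.
move=> a0 aS j; rewrite /conv big_ord_recl [in RHS]big_ord_recl a0 -addrA.
congr (_ + _); rewrite mulr_sumr -big_split; apply: eq_bigr => i _ /=.
by rewrite /bump add1n aS subSS mulrDl mulrA.
Qed.

(** In generating functions: [(1 - c z^2) b' = b], multiplied by [a]. *)
Lemma conv_recr a b b' c : b' 0%N = b 0%N -> b' 1%N = b 1%N ->
    (forall n, b' n.+2 = b n.+2 + c * b' n) ->
  forall j, conv a b' j.+2 = conv a b j.+2 + c * conv a b' j.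
Proof.
move=> b0 b1 bS j; rewrite /conv 2!big_ord_recr [in RHS]big_ord_recr.
rewrite [in RHS]big_ord_recr /= subnn b0.
have -> : (j.+2 - j.+1 = 1)%N by lia.
rewrite b1 -!addrA [in RHS]addrC -!addrA; rewrite [in RHS]addrCA.
rewrite [in RHS]addrC -!addrA.
have -> : \sum_(i < j.+1) a i * b' (j.+2 - i)%N =
  \sum_(i < j.+1) a i * b (j.+2 - i)%N + c * \sum_(i < j.+1) a i * b' (j - i)%N.
  rewrite mulr_sumr -big_split; apply: eq_bigr => i _ /=.
  have -> : (j.+2 - i = (j - i).+2)%N by have := ltn_ord i; lia.
  by rewrite bS; ring.
by ring.
Qed.

(* On generating functions: [a' = (1 + c z) a] and [(1 - c^2 z^2) b' = b] give
   [(1 - c z) a' b' = a b]; the factor [1 + c z] is cancelled by induction. *)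
Lemma conv_cancel a a' b b' c : a' 0%N = a 0%N -> b' 0%N = b 0%N ->
    b' 1%N = b 1%N -> a 0%N = b 0%N ->
    (forall m, a' m.+1 = a m.+1 + c * a m) ->
    (forall n, b' n.+2 = b n.+2 + c ^+ 2 * b' n) ->
  forall j, conv a' b' j.+1 = conv a b j.+1 + c * conv a' b' j.
Proof.
move=> a0 b0 b1 ab aS bS; elim=> [|j IHj].
  rewrite /conv !big_ord_recr !big_ord0 /= !subn0 !subnn a0 b0 b1 aS; ring.
rewrite (conv_recr a' b0 b1 bS) (conv_recl b a0 aS).
(* The induction hypothesis times [c] accounts for both lower-order terms. *)
by rewrite IHj; ring.
Qed.

End Convolution.

(** * The double sums and the recurrence of their coefficients *)

Section CoefficientSide.
Variables (F : fieldType) (q : F).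
Hypothesis q_generic : forall k : nat, (0 < k)%N -> q ^+ k != 1.

Let q4_generic k : (0 < k)%N -> (q ^+ 4) ^+ k != 1.
Proof. by move=> k_gt0; rewrite -exprM q_generic ?muln_gt0. Qed.

(* The two factors [(-z q; q)_A] and [(1 + z) / (z^2; q^4)_(B+1)] of [F_A(z)],
   expanded by the q-binomial theorem. *)
Definition ecoef (A m : nat) : F := q ^+ 'C(m.+1, 2) * qbinom q A m.

Definition hcoef (B n : nat) : F := qbinom (q ^+ 4) (B + n./2)%N n./2.

Definition fcoef (A j : nat) : F := conv (ecoef A) (hcoef A./2) j.

Lemma ecoef0 A : ecoef A 0 = 1.
Proof. by rewrite /ecoef bin_small // mul1r (qbinom0 q_generic). Qed.

(** The product [(-z q; q)_A] gains the factor [1 + z q^(A+1)]. *)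
Lemma ecoefS A m : ecoef A.+1 m.+1 = ecoef A m.+1 + q ^+ A.+1 * ecoef A m.
Proof.
rewrite /ecoef (qbinom_pascal q_generic) mulrDr; congr (_ + _).
(* For [A < m] the exponent [A - m] is truncated and the powers need not match, but the binomial
   vanishes. *)
have [ltAm|lemA] := ltnP A m; first by rewrite qbinom_small ?mulr0.
rewrite !mulrA -!exprD; congr (_ ^+ _ * _).
by rewrite (binS m.+1 1) bin1; lia.
Qed.

Lemma hcoef_lt2 B n : (n < 2)%N -> hcoef B n = 1.
Proof.
by case: n => [|[|]] // _; rewrite /hcoef /= (qbinom0 q4_generic).
Qed.

(** The denominator gains the factor [1 - z^2 q^(4 (B + 1))]. *)
Lemma hcoefSS B n :
  hcoef B.+1 n.+2 = hcoef B n.+2 + (q ^+ B.+1.*2) ^+ 2 * hcoef B.+1 n.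
Proof.
rewrite /hcoef /= addSnnS (addSn B) addnS (qbinom_pascal q4_generic) addnS.
congr (_ + _ * _); rewrite -!exprM; congr (_ ^+ _); lia.
Qed.

Lemma fcoef0 A : fcoef A 0 = 1.
Proof. by rewrite /fcoef conv0 ecoef0 hcoef_lt2 ?mulr1. Qed.

Lemma fcoef_odd B j :
  fcoef B.*2.+1 j.+1 = fcoef B.*2 j.+1 + q ^+ B.*2.+1 * fcoef B.*2 j.
Proof.
rewrite /fcoef /= uphalf_double doubleK; apply: conv_recl => [|m].
  by rewrite !ecoef0.
exact: ecoefS.
Qed.

(** With [c = q^(2 B + 2)], the numerator gains [1 + c z] and the denominator [1 - c^2 z^2], in all
    a factor [1 / (1 - c z)]. *)
Lemma fcoef_even B j :
  fcoef B.+1.*2 j.+1 =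
  fcoef B.*2.+1 j.+1 + q ^+ B.+1.*2 * fcoef B.+1.*2 j.
Proof.
rewrite /fcoef doubleK doubleS /= uphalf_double; apply: conv_cancel => //.
- by rewrite !ecoef0.
- by rewrite !hcoef_lt2.
- by rewrite !hcoef_lt2.
- by rewrite ecoef0 hcoef_lt2.
- by move=> m; rewrite ecoefS.
- by move=> n; rewrite hcoefSS doubleS.
Qed.

(** [F_0(z) = (1 + z) / (1 - z^2) = 1 / (1 - z)]. *)
Lemma fcoef_zero j : fcoef 0 j = 1.
Proof.
rewrite /fcoef /conv big_ord_recl ecoef0 big1 ?addr0 => [|i _].
  by rewrite mul1r /hcoef /= add0n (qbinomn q4_generic).
by rewrite /ecoef qbinom_small ?mulr0 ?mul0r.
Qed.

(** The guard matters: beyond it the subtraction truncates to [0], where [fcoef] is [1]. *)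
Definition gcoef (N j : nat) : F :=
  if (j.*2 <= N)%N then q ^+ (j ^ 2 + j) * fcoef (N - j.*2) j else 0.

Lemma gcoef0 N : gcoef N 0 = 1.
Proof. by rewrite /gcoef /= subn0 fcoef0 mulr1. Qed.

Lemma gcoef_big N j : (N < j.*2)%N -> gcoef N j = 0.
Proof. by move=> ltN; rewrite /gcoef leqNgt ltN. Qed.

Lemma gcoef_rec N j : (1 < N)%N ->
  gcoef N j.+1 = gcoef N.-1 j.+1 + q ^+ N * gcoef (N - (2 + odd N)) j.
Proof.
move=> N_gt1; have [ltN|leN] := ltnP N j.+1.*2.
  by rewrite !gcoef_big ?mulr0 ?addr0 //; lia.
have expE : (j.+1 ^ 2 + j.+1 + (N - j.+1.*2) = N + (j ^ 2 + j))%N.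
  by rewrite !expnS expn0; lia.
have leNj : (j.*2 <= N - (2 + odd N))%N by lia.
have [N_odd|N_even] := boolP (odd N).
  have [B EB] : exists B, (N - j.+1.*2 = B.*2.+1)%N.
    by exists ((N - j.+1.*2)./2); lia.
  rewrite N_odd in leNj; rewrite /gcoef leN leNj.
  rewrite (_ : j.+1.*2 <= N.-1)%N; last by lia.
  rewrite EB (_ : N.-1 - j.+1.*2 = B.*2)%N; last by lia.
  rewrite (_ : N - (2 + true) - j.*2 = B.*2)%N; last by lia.
  by rewrite fcoef_odd mulrDr !mulrA -!exprD -expE EB.
have [B EB] : exists B, (N - j.+1.*2 = B.*2)%N.
  by exists ((N - j.+1.*2)./2); lia.
rewrite (negPf N_even) in leNj; rewrite /gcoef leN leNj EB.
rewrite (_ : N - (2 + false) - j.*2 = B.*2)%N; last by lia.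
(* For [B = 0], that is [N = 2 (j + 1)], the guard kills the coefficient at [N.-1], and the other
   two reduce to powers of [q]. *)
case: B => [|B] in EB *.
  rewrite ifF; last by lia.
  by rewrite !fcoef_zero !mulr1 add0r -exprD -expE EB addn0.
rewrite (_ : j.+1.*2 <= N.-1)%N; last by lia.
rewrite (_ : N.-1 - j.+1.*2 = B.*2.+1)%N; last by lia.
rewrite (fcoef_even B j) mulrDr; congr (_ + _).
by rewrite [LHS]mulrA [RHS]mulrA -!(exprD q) -EB expE.
Qed.

Definition gpoly (N : nat) (x : F) : F := \sum_(j < N.+1) x ^+ j * gcoef N j.

Lemma gpoly_widen K N x : (N < K)%N ->
  gpoly N x = \sum_(j < K) x ^+ j * gcoef N j.
Proof.
move=> ltNK; rewrite /gpoly -!(big_mkord xpredT (fun j => x ^+ j * gcoef N j)).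
rewrite [RHS](@big_cat_nat _ _ _ N.+1) //=.
rewrite [X in _ + X]big_nat_cond [X in _ + X]big1 ?addr0 // => j.
by rewrite andbT => /andP[ltNj _]; rewrite gcoef_big ?mulr0 //; lia.
Qed.

Lemma gpoly_rec N x : (1 < N)%N ->
  gpoly N x = gpoly N.-1 x + x * q ^+ N * gpoly (N - (2 + odd N)) x.
Proof.
move=> N_gt1; rewrite (gpoly_widen (K := N.+1) x (ltnSn N)).
rewrite (gpoly_widen (K := N.+1) (N := N.-1)); last by lia.
rewrite (gpoly_widen (K := N) (N := N - _)); last by lia.
rewrite big_ord_recl [in RHS]big_ord_recl !gcoef0 -addrA; congr (_ + _).
rewrite mulr_sumr -big_split; apply: eq_bigr => i _.
by rewrite /= /bump add1n gcoef_rec // exprS; ring.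
Qed.

Lemma gpoly_lt2 N x : (N < 2)%N -> gpoly N x = 1.
Proof.
move=> N_lt2; rewrite /gpoly big_ord_recl gcoef0 mulr1 big1 ?addr0 // => i _.
by rewrite gcoef_big ?mulr0 //= /bump; lia.
Qed.

Definition gterm (x : F) (N : nat) (mn : nat * nat) : F :=
  let: (m, n) := mn in
  x ^+ (m + n) * q ^+ L m n * qbinom q (N%:Z - 2 * m%:Z - 2 * n%:Z) m%:Z
  * qbinom (q ^+ 4) ((N./2)%:Z - m%:Z - n%:Z + (n./2)%:Z) (n./2)%:Z.

Lemma L_binE m n : L m n = ((m + n) ^ 2 + (m + n) + 'C(m.+1, 2))%N.
Proof.
have E : (m ^ 2 + m = ('C(m.+1, 2)).*2)%N.
  elim: m => // m IHm; rewrite (binS m.+1 1) bin1 doubleD -IHm.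
  by rewrite !expnS !expn0; lia.
rewrite /L E -doubleMr doubleK.
by move: E; rewrite !expnS !expn0; nia.
Qed.

(** For [N < 2 (m + n)] the first binomial has a negative top and vanishes; otherwise the integer
    differences agree with the truncated ones. *)
Lemma gtermE x N m n :
  gterm x N (m, n) =
  if ((m + n).*2 <= N)%N then
    x ^+ (m + n) * (q ^+ ((m + n) ^ 2 + (m + n))
      * (ecoef (N - (m + n).*2) m * hcoef (N - (m + n).*2)./2 n))
  else 0.
Proof.
rewrite /gterm; case: ifPn => [le|nle]; last first.
  rewrite [X in _ * X * _](_ : _ = 0) ?mulr0 ?mul0r //.
  by rewrite /qbinom ifF //; lia.
rewrite L_binE (exprD q) /ecoef /hcoef.
have -> : N%:Z - 2 * m%:Z - 2 * n%:Z = (N - (m + n).*2)%N%:Z by lia.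
have -> : (N./2)%:Z - m%:Z - n%:Z + (n./2)%:Z =
   ((N - (m + n).*2)./2 + n./2)%N%:Z by lia.
by rewrite !mulrA.
Qed.

Lemma gterm_sum x N :
  \sum_(mn \in [set: nat * nat]) gterm x N mn = gpoly N x.
Proof.
rewrite (fsbig_antidiagonals (N := N)) => [|m n ltN]; last first.
  by rewrite gtermE ifF //; lia.
apply: eq_bigr => j _; rewrite /gcoef /fcoef /conv.
case: ifPn => [le|nle]; last first.
  rewrite mulr0 big1 // => i _; rewrite gtermE ifF //.
  by have := ltn_ord i; lia.
rewrite !mulr_sumr; apply: eq_bigr => i _; rewrite gtermE.
by rewrite subnKC ?le // -ltnS.
Qed.

Lemma gterm_shift_sum x N :
  \sum_(mn \in [set: nat * nat]) (let: (m, n) := mn in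
    x ^+ (m + n + 1) * q ^+ (L m n + 2 * m + 2 * n + 1)
    * qbinom q (N%:Z - 2 * m%:Z - 2 * n%:Z - 2) m%:Z
    * qbinom (q ^+ 4)
        ((N./2)%:Z - m%:Z - n%:Z - 1 + (n./2)%:Z) (n./2)%:Z)
  = if (1 < N)%N then x * q * gpoly (N - 2) (x * q ^+ 2) else 0.
Proof.
case: ifPn => [N_gt1|]; last first.
  rewrite -leqNgt => N_le1; apply: fsbig1 => -[m n] _.
  rewrite [X in _ * X * _](_ : _ = 0) ?mulr0 ?mul0r //.
  by rewrite /qbinom ifF //; lia.
(* The terms for [N - 2] vanish beyond the bound for [N] too, so both sums can be cut at the same
   [N] and compared termwise. *)
rewrite -gterm_sum !(fsbig_antidiagonals (N := N)) => [|m n ltN|m n ltN].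
- rewrite mulr_sumr; apply: eq_bigr => j _.
  rewrite mulr_sumr; apply: eq_bigr => i _; rewrite /gterm.
  set m := nat_of_ord i; set n := (j - i)%N.
  have -> : (N - 2)%N%:Z - 2 * m%:Z - 2 * n%:Z
    = N%:Z - 2 * m%:Z - 2 * n%:Z - 2 by lia.
  have -> : ((N - 2)./2)%:Z - m%:Z - n%:Z + (n./2)%:Z
    = (N./2)%:Z - m%:Z - n%:Z - 1 + (n./2)%:Z by lia.
  have -> : (L m n + 2 * m + 2 * n + 1 = L m n + 2 * (m + n) + 1)%N by lia.
  move: (L m n) => l.
  have -> : q ^+ (l + 2 * (m + n) + 1) = q ^+ l * (q ^+ 2) ^+ (m + n) * q.
    by rewrite addn1 exprSr (exprD q l) exprM.
  rewrite addn1 exprS (exprMn _ x).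
  move: (x ^+ (m + n)) ((q ^+ 2) ^+ (m + n)) (q ^+ l) => y1 y2 y3.
  by move: (qbinom q _ _) (qbinom (q ^+ 4) _ _) => b1 b2; ring.
- by rewrite gtermE ifF //; lia.
rewrite [X in _ * X * _](_ : _ = 0) ?mulr0 ?mul0r //.
by rewrite /qbinom ifF //; lia.
Qed.

End CoefficientSide.

(** * Partitions: removing the largest part *)

Section PartitionSide.

Lemma little_gapE a b : little_gap a b = (a + 2 + odd b <= b)%N.
Proof. by rewrite /little_gap; lia. Qed.

Lemma little_gap_trans : transitive little_gap.
Proof. by move=> b a c; rewrite !little_gapE; lia. Qed.

(** [little_gap] is transitive and implies [leq], so one pairwise condition, easy to split along
    [rcons], replaces both sortedness tests. *)
Lemma lG_pairwise i N s : lG i N s <->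
  all (fun a => [&& 0 < a, i <= a & a <= N]%N) s && pairwise little_gap s.
Proof.
rewrite /lG /= /is_partition (sorted_pairwise little_gap_trans).
rewrite (sorted_pairwise leq_trans).
split.
  move=> /and3P[/andP[_ pos] bnd ->]; rewrite andbT.
  by apply/allP => a sa; rewrite (allP pos) // (allP bnd).
move=> /andP[bnd gap]; rewrite gap andbT -andbA; apply/and3P; split.
- apply: sub_pairwise gap => a b; rewrite little_gapE; lia.
- by apply: sub_all bnd => a /and3P[].
- by apply: sub_all bnd => a /and3P[_ -> ->].
Qed.

Lemma lG_small i N : (N < i)%N || (N == 0)%N -> lG i N = [set [::]]%classic.
Proof.
move=> small; apply/seteqP; split=> [[|a s] //|_ ->] //.
by move=> /lG_pairwise /= /andP[/andP[/and3P[? ? ?] _] _]; lia.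
Qed.

(** For [N = 1] the difference truncates to [0], which is harmless: [lG i 0] holds only the empty
    partition. *)
Lemma lG_rec i N : (i <= N)%N -> (0 < N)%N ->
  lG i N = (lG i N.-1 `|` (rcons^~ N) @` lG i (N - (2 + odd N)))%classic.
Proof.
move=> leiN N_gt0; apply/seteqP; split=> [s|s [|[t]]].
- case: (lastP s) => [|t a] /lG_pairwise.
    by move=> _; left.
  rewrite all_rcons pairwise_rcons.
  move=> /andP[/andP[/and3P[a_gt0 leia leaN] bnd] /andP[gapa gap]].
  have [ltaN|leNa] := ltnP a N.
    left; apply/lG_pairwise; rewrite all_rcons pairwise_rcons gapa gap !andbT.
    rewrite a_gt0 leia /=; apply/andP; split; first by lia.
    apply/allP => b tb; have := allP bnd b tb.
    by have := allP gapa b tb; rewrite little_gapE; lia.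
  have Ea : a = N by lia.
  right; exists t; last by rewrite Ea.
  apply/lG_pairwise; rewrite gap andbT; apply/allP => b tb.
  have := allP bnd b tb; have := allP gapa b tb.
  by rewrite little_gapE Ea; lia.
- move=> /lG_pairwise/andP[bnd gap]; apply/lG_pairwise; rewrite gap andbT.
  by apply: sub_all bnd => a; lia.
move=> /lG_pairwise/andP[bnd gap] <-; apply/lG_pairwise.
rewrite all_rcons pairwise_rcons gap leiN N_gt0 leqnn /=.
apply/andP; split; first by apply: sub_all bnd => a; lia.
by rewrite andbT; apply: sub_all bnd => a; rewrite little_gapE; lia.
Qed.

Lemma finite_lG i N : finite_set (lG i N).
Proof.
elim/ltn_ind: N => N IHN.
have [small|] := boolP ((N < i) || (N == 0))%N.
  by rewrite lG_small //; exact: finite_set1.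
rewrite negb_or -leqNgt -lt0n => /andP[leiN N_gt0].
rewrite lG_rec // finite_setU; split; first by apply: IHN; lia.
by apply: finite_image; apply: IHN; lia.
Qed.

Definition lGpoly (F : fieldType) (x q : F) (i N : nat) : F :=
  \sum_(s \in lG i N) x ^+ size s * q ^+ sumn s.

Lemma lGpoly_small (F : fieldType) (x q : F) i N :
  (N < i)%N || (N == 0)%N -> lGpoly x q i N = 1.
Proof. by move=> small; rewrite /lGpoly lG_small // fsbig_set1 mulr1. Qed.

Lemma lGpoly_rec (F : fieldType) (x q : F) i N : (i <= N)%N -> (0 < N)%N ->
  lGpoly x q i N
  = lGpoly x q i N.-1 + x * q ^+ N * lGpoly x q i (N - (2 + odd N)).
Proof.
move=> leiN N_gt0; rewrite {1}/lGpoly lG_rec // fsbigU0.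
- congr (_ + _); rewrite fsbig_image => [|s t _ _ /rcons_inj[]] //.
  rewrite fsbig_distrr; last exact: finite_lG.
  apply: eq_fsbigr => s _; rewrite size_rcons sumn_rcons exprS exprD.
  by rewrite /=; ring.
- exact: finite_lG.
- by apply: finite_image; exact: finite_lG.
(* The union is disjoint: a part [N] exceeds the bound [N.-1]. *)
move=> s [/lG_pairwise/andP[bnd _] [t _ E]]; move: bnd.
by rewrite -E all_rcons; lia.
Qed.

End PartitionSide.

(** * Both sides satisfy the same recurrence *)

Section Comparison.
Variables (F : fieldType) (x q : F).
Hypothesis q_generic : forall k : nat, (0 < k)%N -> q ^+ k != 1.

Lemma lGpoly2E N : lGpoly x q 2 N = gpoly q N x.
Proof.
elim/ltn_ind: N => N IHN; have [N_lt2|N_gt1] := ltnP N 2.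
  by rewrite lGpoly_small ?N_lt2 // (gpoly_lt2 q_generic).
rewrite lGpoly_rec //; last exact: ltnW.
by rewrite (gpoly_rec q_generic x N_gt1) !IHN //; lia.
Qed.

Lemma lGpoly1E N :
  lGpoly x q 1 N = gpoly q N x
    + (if (1 < N)%N then x * q * gpoly q (N - 2) (x * q ^+ 2) else 0)
    + (N == 1%N)%:R * x * q.
Proof.
have g2 n y := gpoly_lt2 q_generic (N := n) y.
have gr n y := gpoly_rec q_generic (N := n) y.
have l0 : lGpoly x q 1 0 = 1 by rewrite lGpoly_small.
have l1 : lGpoly x q 1 1 = 1 + x * q by rewrite lGpoly_rec //= l0 mulr1 expr1.
have l2 : lGpoly x q 1 2 = 1 + x * q + x * q ^+ 2.
  by rewrite lGpoly_rec //= l1 l0 mulr1.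
elim/ltn_ind: N => -[_|[_|[_|[_|N IHN]]]].
- by rewrite l0 g2 // mul0r mul0r !addr0.
- by rewrite l1 g2 //= addr0 mul1r.
- by rewrite l2 gr // !g2 //=; ring.
- by rewrite lGpoly_rec //= l2 l0 gr //= gr // !g2 //=; ring.
rewrite lGpoly_rec // !IHN; try lia.
rewrite (gr N.+4) //= (gr (N.+4 - 2)%N) //=; rewrite !negbK.
set k := (N.+4 - (2 + odd N))%N; have k_gt1 : (1 < k)%N by rewrite /k; lia.
rewrite k_gt1 (_ : (k == 1) = false)%N; last by lia.
have -> : (N.+4 - 2 - (2 + odd N) = k - 2)%N by rewrite /k; lia.
have -> : (N.+4 - 2 = N.+2)%N by lia.
have -> : (N.+3 - 2 = N.+1)%N by lia.
(* At [x q^2] the recurrence has weight [(x q^2) q^(N+2) = x q^(N+4)], as for the other term. *)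
rewrite mulr0n (exprD q 2 N.+2 : q ^+ N.+4 = _).
by move: (gpoly _ _ _) (gpoly _ _ _) (gpoly _ _ _) (gpoly _ _ _) => a b c d; ring.
Qed.

End Comparison.

Unset Implicit Arguments.

(* [\sum_(i \in A)] sums the nonzero values of a finitely supported family.
   The sets [lG i N] are finite, and a first q-binomial factor vanishes unless
   3 m + 2 n <= N, so every sum below is a genuine one. *)
Theorem theorem4p3 (F : fieldType) (x q : F)
    (q_generic : forall k : nat, (0 < k)%N -> q ^+ k != 1) (N : nat) :
  \sum_(s \in lG 1 N) x ^+ size s * q ^+ sumn s
    = \sum_(mn \in [set: nat * nat]) (let: (m, n) := mn in
          x ^+ (m + n) * q ^+ L m n
          * qbinom q (N%:Z - 2 * m%:Z - 2 * n%:Z) m%:Z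
          * qbinom (q ^+ 4)
              ((N./2)%:Z - m%:Z - n%:Z + (n./2)%:Z) (n./2)%:Z)
      + \sum_(mn \in [set: nat * nat]) (let: (m, n) := mn in
          x ^+ (m + n + 1) * q ^+ (L m n + 2 * m + 2 * n + 1)
          * qbinom q (N%:Z - 2 * m%:Z - 2 * n%:Z - 2) m%:Z
          * qbinom (q ^+ 4)
              ((N./2)%:Z - m%:Z - n%:Z - 1 + (n./2)%:Z) (n./2)%:Z)
      + (N == 1%N)%:R * x * q
  /\
  \sum_(s \in lG 2 N) x ^+ size s * q ^+ sumn s
    = \sum_(mn \in [set: nat * nat]) (let: (m, n) := mn in
          x ^+ (m + n) * q ^+ L m n
          * qbinom q (N%:Z - 2 * m%:Z - 2 * n%:Z) m%:Z
          * qbinom (q ^+ 4)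
              ((N./2)%:Z - m%:Z - n%:Z + (n./2)%:Z) (n./2)%:Z).
Proof.
rewrite -/(lGpoly x q 1 N) -/(lGpoly x q 2 N).
rewrite (lGpoly1E _ q_generic) (lGpoly2E _ q_generic).
by rewrite -gterm_sum gterm_shift_sum.
Qed.
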